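(* Let $0<u\le s\le t\le q\le r\le n$ be integers and let $I=P_1\cap P_2\cap P_3\subset S=K[x_1,\dots,x_n]$, where $P_1=(x_1,\dots,x_t)$, $P_2=(x_{s+1},\dots,x_r)$ and $P_3=(x_{q+1},\dots,x_n,x_1,\dots,x_u)$, with $P_i\not\subset P_j$ for all $i\ne j$. Let $d=(s-u)+(q-t)+(n-r)$ and suppose $n-d\ge 3$. Then, provided the denominator below is nonzero, $$\operatorname{sdepth}(I)\le 2+d+\frac{\binom{n-d}{3}-\binom{u}{3}-\binom{t-s}{3}-\binom{r-q}{3}}{\binom{n-d}{2}-\binom{u}{2}-\binom{t-s}{2}-\binom{r-q}{2}}.$$
   Context: $K$ is a field and $S=K[x_1,\dots,x_n]$ is the polynomial ring, with its standard $\mathbb{Z}^n$-grading. Binomial coefficients $\binom{a}{b}$ are $0$ when $a<b$; the quotient is a quotient of rational numbers. Let $M$ be a finitely generated $\mathbb{Z}^n$-graded $S$-module. For a homogeneous $u\in M$ and a subset $Z\subset\{x_1,\dots,x_n\}$, $uK[Z]$ denotes the $K$-subspace of $M$ generated by all $uv$, $v$ a monomial in $K[Z]$; if $uK[Z]$ is a free $K[Z]$-module it is called a Stanley space of dimension $|Z|$. A Stanley decomposition of $M$ is a presentation of $M$ as a finite direct sum of $\mathbb{Z}^n$-graded $K$-vector spaces $\mathcal{D}: M=\bigoplus_{i}u_iK[Z_i]$ with each $u_iK[Z_i]$ a Stanley space; $\operatorname{sdepth}\mathcal{D}=\min_i|Z_i|$, and $\operatorname{sdepth} M$ is the maximum of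 $\operatorname{sdepth}\mathcal{D}$ over all Stanley decompositions $\mathcal{D}$ of $M$. *)

(* Defs.v *)
From HB Require Import structures.
From mathcomp Require Import all_boot all_order all_algebra.
From mathcomp Require Import boolp.
From mathcomp Require Import mpoly.

Set Implicit Arguments.
Unset Strict Implicit.
Unset Printing Implicit Defensive.

Import Order.TTheory GRing.Theory Num.Theory.
Local Open Scope ring_scope.

(* A Z^n-graded S-module, S = K[x_1, ..., x_n], is given here as a graded
   submodule M : V -> Prop of an ambient S-module V whose component of degree
   a : 'I_n -> int is [comp a : V -> Prop] (one may take M = V).  The scalar
   c : K acts on V as the constant polynomial c%:MP. *)
Section Stanley.

Variables (K : fieldType) (n : nat).
Variable V : lmodType {mpoly K[n]}.
Variable comp : ('I_n -> int) -> V -> Prop.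

Definition homogeneous (u : V) : Prop := exists a, comp a u.

(* The subring K[Z] of S. *)
Definition polyIn (Z : {set 'I_n}) (f : {mpoly K[n]}) : Prop :=
  forall m : 'X_{1..n}, m \in msupp f -> forall i, m i != 0%N -> i \in Z.

(* A polynomial f in K[Z] is a finite K-combination of monomials v of K[Z], so
   the elements f *: u are exactly those of the K-span of the products v *: u. *)
Definition uKZ (u : V) (Z : {set 'I_n}) (w : V) : Prop :=
  exists2 f, polyIn Z f & w = f *: u.

(* uK[Z] is free over K[Z] with basis u; in particular u <> 0. *)
Definition stanley_space (u : V) (Z : {set 'I_n}) : Prop :=
  forall f, polyIn Z f -> f *: u = 0 -> f = 0.

Variable M : V -> Prop.

Definition direct_sum (l : nat) (W : 'I_l -> V -> Prop) : Prop :=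
  (forall m, M m <->
     exists2 w : 'I_l -> V, (forall i, W i (w i)) & m = \sum_(i < l) w i) /\
  (forall w w' : 'I_l -> V, (forall i, W i (w i)) -> (forall i, W i (w' i)) ->
     \sum_(i < l) w i = \sum_(i < l) w' i -> forall i, w i = w' i).

Definition stanley_decomposition (l : nat) (u : 'I_l -> V)
    (Z : 'I_l -> {set 'I_n}) : Prop :=
  [/\ forall i, M (u i) /\ homogeneous (u i),
      forall i, stanley_space (u i) (Z i)
    & direct_sum (fun i => uKZ (u i) (Z i))].

(* The default value n only matters for l = 0, i.e. M = 0, as #|Z i| <= n. *)
Definition sdepth_dec (l : nat) (Z : 'I_l -> {set 'I_n}) : nat :=
  \big[minn/n]_(i < l) #|Z i|.

(* The maximum ranges over all values taken by sdepth_dec, as these are <= n. *)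
Definition sdepth : nat :=
  \max_(k < n.+1 | `[< exists l (u : 'I_l -> V) (Z : 'I_l -> {set 'I_n}),
      stanley_decomposition u Z /\ sdepth_dec Z = k >]) k.

End Stanley.

Section PolynomialRing.

Variables (K : fieldType) (n : nat).

(* The standard Z^n-grading of S: the component of degree a is K x^a if
   a >= 0, and 0 otherwise. *)
Definition mpoly_comp (a : 'I_n -> int) (f : {mpoly K[n]}^o) : Prop :=
  forall m : 'X_{1..n}, m \in msupp (f : {mpoly K[n]}) ->
    forall i, a i = (m i)%:Z.

Definition sdepth_ideal (I : {mpoly K[n]} -> Prop) : nat :=
  sdepth (V := {mpoly K[n]}^o) mpoly_comp I.

(* The ideal generated by the x_k with P k; the variable x_k, 1 <= k <= n, is
   'X_i for the i : 'I_n such that i.+1 = k. *)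
Definition var_ideal (P : pred nat) (f : {mpoly K[n]}) : Prop :=
  exists g : 'I_n -> {mpoly K[n]}, f = \sum_(i < n | P i.+1) g i * 'X_i.

End PolynomialRing.

(* Main.v *)
Require Import Defs.
From mathcomp Require Import all_boot all_order all_algebra.
From mathcomp Require Import boolp.
From mathcomp Require Import mpoly zify ring.

Set Implicit Arguments.
Unset Strict Implicit.
Unset Printing Implicit Defensive.

Import Order.TTheory GRing.Theory Num.Theory.
Local Open Scope ring_scope.

(** Let A1, A2, A3 be the three blocks of variables x_1..x_u, x_(s+1)..x_t and
    x_(q+1)..x_r, which generate, respectively, the common part of P1 and P3,
    of P1 and P2, and of P2 and P3.  Let N be their union; each of the other d
    variables lies in exactly one of the three primes.  A squarefree monomial
    in the variables of N lies in I exactly when its support is contained in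
    none of the blocks ([sqfree_inter3]).  So for k > 0 the number of such
    monomials of degree k is C(n-d,k) - C(u,k) - C(t-s,k) - C(r-q,k)
    ([card_mixed_sets]), which is den for k = 2 and num for k = 3, and none of
    them has degree less than 2.

    A Stanley decomposition of an ideal spanned by monomials partitions the
    exponents of these monomials into translated orthants mu_i + N^(Z_i)
    ([stanley_orthants]), where mu_i is the exponent of u_i.  Let v be a
    squarefree monomial of the ideal in the variables of N, of the least degree
    g that occurs.  Its exponent lies in some orthant, whose origin divides v
    and belongs to the ideal, hence is v by minimality.  If every Z_i has at
    least h elements, at most d of those in the Z_i of v lie outside N and at
    most g of them divide v.  For the other x_j in Z_i, at least h - d - g in
    number, the monomials v x_j of degree g + 1 are squarefree and lie in the
    same orthant.  Those obtained from different v are different because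
    orthants do not meet, so the number of monomials v times h - d - g is at
    most the number of squarefree monomials of the ideal of degree g + 1 in the
    variables of N ([sdepth_ideal_count]).  For g = 2 this says that
    den * (sdepth I - d - 2) <= num. *)

(** * Monomials in variable ideals *)

Definition monomial_closed (K : fieldType) (n : nat)
    (M : {mpoly K[n]} -> Prop) : Prop :=
  forall f m, M f -> m \in msupp f -> M 'X_[m].

Lemma var_ideal_msupp (K : fieldType) n (P : pred nat) (f : {mpoly K[n]}) m :
  var_ideal P f -> m \in msupp f -> exists2 i : 'I_n, P i.+1 & m i != 0%N.
Proof.
case=> g -> /msupp_sum_le /flattenP [ms /mapP [i]].
rewrite mem_filter => /andP [Pi _] -> /msuppM_le /allpairsP [[m1 m2] /= [_]].
rewrite msuppX inE => /eqP -> ->; exists i => //.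
by rewrite mnmDE mnm1E eqxx addn1.
Qed.

Lemma var_ideal_mpolyX (K : fieldType) n (P : pred nat) (m : 'X_{1..n}) :
  var_ideal P ('X_[m] : {mpoly K[n]}) <->
  exists2 i : 'I_n, P i.+1 & m i != 0%N.
Proof.
split=> [Pm|[i Pi mi]].
  by apply: var_ideal_msupp Pm _; rewrite msuppX inE.
have le_im : (U_(i) <= m)%MM.
  by apply/mnm_lepP => j; rewrite mnm1E; case: eqP => // <-; rewrite lt0n.
exists (fun j => if j == i then 'X_[m - U_(i)] else 0).
rewrite (bigD1 i) //= eqxx big1 ?addr0 => [|j /andP[_ /negPf ->]].
  by rewrite -mpolyXD submK.
by rewrite mul0r.
Qed.

Lemma monomial_closed_var_ideal (K : fieldType) n (P : pred nat) :
  monomial_closed (@var_ideal K n P).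
Proof. by move=> f m Pf mf; apply/var_ideal_mpolyX/(var_ideal_msupp Pf mf). Qed.

(** * Stanley decompositions as partitions of exponents *)

(** The components of the standard grading are at most one-dimensional. *)
Lemma homogeneous_mpoly (K : fieldType) n (f : {mpoly K[n]}) :
  homogeneous (V := {mpoly K[n]}^o) (@mpoly_comp K n) f -> f != 0 ->
  exists2 m, m \in msupp f & f = f@_m *: 'X_[m].
Proof.
case=> a fa f0; have: msupp f != [::] by rewrite msupp_eq0.
case def_s: (msupp f) => [//|m s] _.
have mf : m \in msupp f by rewrite def_s mem_head.
exists m; rewrite -?def_s //; apply/mpolyP => k.
rewrite mcoeffZ mcoeffX; case: eqP => [->|/eqP neq]; first by rewrite mulr1.
rewrite mulr0; apply: memN_msupp_eq0; apply: contra neq => kf.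
apply/eqP/mnmP => i; have := fa k kf i; rewrite (fa m mf i).
by case.
Qed.

(** Membership of m in the set of exponents of the monomials of X^mu K[Z]. *)
Definition in_orthant (n : nat) (mu : 'X_{1..n}) (Z : {set 'I_n})
    (m : 'X_{1..n}) : Prop :=
  (mu <= m)%MM /\ forall i, m i != mu i -> i \in Z.

Lemma uKZ_msupp (K : fieldType) n (c : K) mu (Z : {set 'I_n})
    (f : {mpoly K[n]}) m :
  uKZ (V := {mpoly K[n]}^o) (c *: 'X_[mu]) Z f -> m \in msupp f ->
  in_orthant mu Z m.
Proof.
case=> g gZ ->; rewrite [_ *: _](_ : _ = g * (c *: 'X_[mu])) //.
rewrite -scalerAr => /msuppZ_le.
rewrite (perm_mem (msuppMX _ _)) => /mapP [k kg ->]; split.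
  by apply/mnm_lepP => i; rewrite mnmDE leq_addr.
by move=> i; rewrite mnmDE => ki; apply: (gZ k) => //; lia.
Qed.

Lemma uKZ_mpolyX (K : fieldType) n (c : K) mu (Z : {set 'I_n}) m :
  c != 0 -> in_orthant mu Z m ->
  uKZ (V := {mpoly K[n]}^o) (c *: 'X_[mu]) Z ('X_[m] : {mpoly K[n]}).
Proof.
move=> c0 [le_mu_m mZ]; exists (c^-1 *: 'X_[m - mu]).
  move=> k /msuppZ_le; rewrite msuppX inE => /eqP -> i.
  by rewrite mnmBE => ki; apply: mZ; lia.
rewrite [RHS](_ : _ = (c^-1 *: 'X_[m - mu]) * (c *: 'X_[mu])) //.
by rewrite -scalerAr -scalerAl scalerA mulfV // scale1r -mpolyXD submK.
Qed.

(** A monomial of M is the sum of components in the Stanley spaces, one of which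
    must have that monomial in its support, and each Stanley space is spanned by
    its monomials.  A monomial in two of the spaces would have two
    decompositions, each with a single nonzero component. *)
Lemma stanley_orthants (K : fieldType) n (M : {mpoly K[n]} -> Prop) l
    (u : 'I_l -> {mpoly K[n]}^o) (Z : 'I_l -> {set 'I_n}) :
  stanley_decomposition (@mpoly_comp K n) M u Z ->
  exists2 mu : 'I_l -> 'X_{1..n}, forall i, mu i \in msupp (u i) &
    (forall m, M 'X_[m] <-> exists i, in_orthant (mu i) (Z i) m) /\
    (forall m i j, in_orthant (mu i) (Z i) m -> in_orthant (mu j) (Z j) m ->
       i = j).
Proof.
case=> Mu uZ [sumP sum_inj].
have /choice [mu muP] i : exists m, m \in msupp (u i : {mpoly K[n]}) /\
    (u i : {mpoly K[n]}) = (u i : {mpoly K[n]})@_m *: 'X_[m].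
  have [_ hom_u] := Mu i.
  case: (homogeneous_mpoly hom_u) => [|m]; last by exists m.
  apply/eqP => u0; case/eqP: (oner_neq0 {mpoly K[n]}).
  apply: (uZ i); last by rewrite u0 scaler0.
  by move=> m; rewrite msupp1 inE => /eqP -> j; rewrite mnm0E.
have inW i m : in_orthant (mu i) (Z i) m ->
    uKZ (u i) (Z i) ('X_[m] : {mpoly K[n]}).
  case: (muP i) => mui -> mZ; apply: uKZ_mpolyX => //.
  by rewrite -mcoeff_msupp.
have W0 i : uKZ (u i) (Z i) 0.
  by exists 0; rewrite ?scale0r // => m; rewrite msupp0.
(* The family of components whose only nonzero member is X^m, in place i. *)
pose delta (i : 'I_l) (m : 'X_{1..n}) (j : 'I_l) : {mpoly K[n]}^o :=
  if j == i then ('X_[m] : {mpoly K[n]}) else 0.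
have deltaW i m : in_orthant (mu i) (Z i) m ->
    forall j, uKZ (u j) (Z j) (delta i m j).
  by move=> mZ j; rewrite /delta; case: eqP => // ->; apply: inW.
have sum_delta i m : \sum_j delta i m j = ('X_[m] : {mpoly K[n]}).
  by rewrite (bigD1 i) //= big1 /delta ?eqxx ?addr0 // => j /negPf ->.
exists mu; first by move=> i; case: (muP i).
split=> [m|m i j mi mj].
  split=> [/sumP [w wW Xm]|[i mi]]; last first.
    by apply/sumP; exists (delta i m); [apply: deltaW | rewrite sum_delta].
  have: m \in msupp (\sum_(i < l) w i : {mpoly K[n]}).
    by rewrite -Xm msuppX inE.
  case/msupp_sum_le/flattenP => ms /mapP [i _ ->] mwi; exists i.
  by move: (wW i); case: (muP i) => _ -> wWi; apply: uKZ_msupp wWi mwi.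
apply/eqP; case: (boolP (i == j)) => // neq_ij.
have := sum_inj _ _ (deltaW i m mi) (deltaW j m mj).
rewrite !sum_delta => /(_ erefl i); rewrite /delta eqxx (negPf neq_ij).
move/(congr1 (fun f : {mpoly K[n]} => f@_m)).
by rewrite mcoeffX eqxx mcoeff0 => /eqP; rewrite oner_eq0.
Qed.

(** * Counting squarefree monomials *)

Lemma sdepth_dec_le n l (Z : 'I_l -> {set 'I_n}) i : (sdepth_dec Z <= #|Z i|)%N.
Proof.
(* The default value of the minimum is not neutral for minn, so the term of
   index i cannot be extracted by the lemmas on monoid laws. *)
rewrite /sdepth_dec; have := mem_index_enum i.
elim: (index_enum _) => // j js IH; rewrite big_cons in_cons geq_min.
by case/predU1P => [->|/IH ->]; rewrite ?leqnn ?orbT.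
Qed.

Definition sqfree (K : fieldType) n (M : {mpoly K[n]} -> Prop)
    (N : {set 'I_n}) (k : nat) : {set {set 'I_n}} :=
  [set A : {set 'I_n} |
    [&& A \subset N, #|A| == k & `[< M 'X_[mesym1 A] >]]].

(** Each squarefree monomial of least degree g in the variables of N is the
    origin of an orthant, and multiplying it by one further variable of the
    orthant that lies in N gives a squarefree monomial of degree g + 1; the
    orthants are disjoint, so no monomial arises twice. *)
Lemma stanley_count (K : fieldType) n (M : {mpoly K[n]} -> Prop)
    (N : {set 'I_n}) g l (u : 'I_l -> {mpoly K[n]}^o) (Z : 'I_l -> {set 'I_n}) :
  monomial_closed M ->
  (forall A : {set 'I_n}, A \subset N -> M 'X_[mesym1 A] -> (g <= #|A|)%N) ->
  stanley_decomposition (@mpoly_comp K n) M u Z ->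
  (#|sqfree M N g| * (sdepth_dec Z - (g + #|~: N|)) <= #|sqfree M N g.+1|)%N.
Proof.
move=> monM minM decM; have [Mu _ _] := decM.
have [mu muP [cover uniq_cover]] := stanley_orthants decM.
pose B i := [set x | mu i x != 0%N].
pose J := [set i | (mu i == mesym1 (B i)) && (B i \in sqfree M N g)].
(* J consists of the orthants whose origin is squarefree, of degree g and in the
   variables of N; every such monomial of M is the origin of its orthant. *)
have leSJ : (#|sqfree M N g| <= #|J|)%N.
  apply: leq_trans (leq_imset_card B J); apply/subset_leq_card/subsetP => A SA.
  have := SA; rewrite inE => /and3P [AN /eqP cardA /asboolP MA].
  have [i [/mnm_lepP le_muA _]] := (cover _).1 MA.
  have mu_sqfree : mu i = mesym1 (B i).
    apply/mnmP => x; move: (le_muA x); rewrite !mnmE inE.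
    by case: (mu i x) => [|[|]] //=; case: (x \in A).
  have BA : B i \subset A.
    apply/subsetP => x; rewrite inE; move: (le_muA x); rewrite mnmE.
    by case: (x \in A) => //; rewrite leqn0 => ->.
  have eqBA : B i = A.
    apply/eqP; rewrite eqEcard BA cardA minM ?(subset_trans BA) //.
    by rewrite -mu_sqfree; apply: monM (muP i); case: (Mu i).
  by apply/imsetP; exists i; rewrite ?eqBA // inE -mu_sqfree eqxx eqBA.
(* The variables of N by which the origin of the i-th orthant may be multiplied
   so as to remain squarefree and in the orthant. *)
pose E i := (Z i :&: N) :\: B i.
have leE i : i \in J -> (sdepth_dec Z - (g + #|~: N|) <= #|E i|)%N.
  rewrite !inE => /and4P [_ _ /eqP cardB _].
  rewrite leq_subLR; apply: leq_trans (sdepth_dec_le Z i) _.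
  rewrite -(cardsID N (Z i)) -(cardsID (B i) (Z i :&: N)) addnAC leq_add2r.
  by rewrite leq_add -?cardB // subset_leq_card ?subsetIr // setDE subsetIr.
apply: leq_trans (leq_mul leSJ (leqnn _)) _; rewrite -sum_nat_const.
apply: (@leq_trans (\sum_(i in J) #|E i|)); first exact: leq_sum.
under eq_bigr => i _ do rewrite -sum1_card.
rewrite pair_big_dep sum1_card.
have orthantU (p : 'I_l * 'I_n) : p.1 \in J -> p.2 \in E p.1 ->
    in_orthant (mu p.1) (Z p.1) (mesym1 (p.2 |: B p.1)).
  case: p => i x /=; rewrite 2!inE => /andP [/eqP muB _].
  move=> /setDP [/setIP [xZ _] _].
  split.
    apply/mnm_lepP => y; rewrite muB !mnmE in_setU1 orbC.
    by case: (y \in B i).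
  move=> y; rewrite muB !mnmE in_setU1.
  by case: (y =P x) => [-> //|_]; rewrite eqxx.
(* Distinct pairs of an orthant i in J and a variable x in E i yield distinct
   monomials: the monomial determines i, hence B i, hence x. *)
rewrite -(@card_in_imset _ _ (fun p : 'I_l * 'I_n => p.2 |: B p.1)).
  apply/subset_leq_card/subsetP => A /imsetP [p /andP [pJ pE] ->].
  have := pJ; rewrite inE => /andP[_]; rewrite !inE => /and3P [BN /eqP cardB _].
  have /setDP [/setIP [_ pN] pNB] := pE.
  rewrite subUset sub1set pN BN cardsU1 pNB cardB eqxx /=.
  by apply/asboolP/cover; exists p.1; apply: orthantU.
move=> [i x] [j y] /andP [/= iJ xE] /andP [/= jJ yE] eqT.
have Ti := orthantU (i, x) iJ xE; have Tj := orthantU (j, y) jJ yE.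
rewrite /= eqT /= in Ti Tj; have eq_ij := uniq_cover _ _ _ Ti Tj.
move: eqT; rewrite -eq_ij => eqT; congr pair.
have : x \in y |: B i by rewrite -eqT setU11.
by case/setDP: xE => _ /negPf xB; rewrite in_setU1 xB orbF => /eqP.
Qed.

Lemma sdepth_ideal_count (K : fieldType) n (M : {mpoly K[n]} -> Prop)
    (N : {set 'I_n}) g :
  monomial_closed M ->
  (forall A : {set 'I_n}, A \subset N -> M 'X_[mesym1 A] -> (g <= #|A|)%N) ->
  (#|sqfree M N g| * (sdepth_ideal M - (g + #|~: N|)) <= #|sqfree M N g.+1|)%N.
Proof.
move=> monM minM; rewrite /sdepth_ideal /sdepth.
elim/big_ind: _ => [|x y lex ley|k /asboolP [l [u [Z [decM <-]]]]].
- (* The value 0 is the maximum over no decomposition at all. *)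
  by rewrite sub0n muln0.
- by rewrite /maxn; case: ifP.
- exact: (stanley_count monM minM decM).
Qed.

(** * Sets contained in none of three blocks *)

Definition mixed_sets (T : finType) (A1 A2 A3 : {set T}) k : {set {set T}} :=
  [set A : {set T} | [&& A \subset A1 :|: A2 :|: A3, #|A| == k,
    ~~ (A \subset A1), ~~ (A \subset A2) & ~~ (A \subset A3)]].

(** A nonempty subset of the union is either mixed or contained in exactly one
    of the three disjoint blocks; the empty set, contained in all of them, is
    why k must be positive. *)
Lemma card_mixed_sets (T : finType) (A1 A2 A3 : {set T}) k :
  (0 < k)%N -> [disjoint A1 & A2] -> [disjoint A1 & A3] -> [disjoint A2 & A3] ->
  (#|mixed_sets A1 A2 A3 k| + 'C(#|A1|, k) + 'C(#|A2|, k) + 'C(#|A3|, k) =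
   'C(#|A1| + #|A2| + #|A3|, k))%N.
Proof.
move=> k0 d12 d13 d23.
have binE (B : {set T}) :
    'C(#|B|, k) = (\sum_(A : {set T} | #|A| == k) (A \subset B))%N.
  rewrite -cards_draws -sum1dep_card big_mkcond [RHS]big_mkcond /=.
  apply: eq_bigr => A _; case: (_ == k); rewrite ?andbF // andbT.
  by case: (_ \subset _).
have -> : (#|A1| + #|A2| + #|A3| = #|A1 :|: A2 :|: A3|)%N.
  have d3 : [disjoint A1 :|: A2 & A3].
    by rewrite -setI_eq0 setIUl setU_eq0 !setI_eq0 d13.
  by move: d12 d3; rewrite -!leq_card_setU => /eqP <- /eqP <-.
rewrite !binE -sum1dep_card.
rewrite [X in (X + _ + _ + _)%N](_ : _ = \sum_(A : {set T} | #|A| == k)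
  (A \in mixed_sets A1 A2 A3 k))%N; last first.
  rewrite big_mkcond [RHS]big_mkcond /=; apply: eq_bigr => A _; rewrite inE.
  by case: (#|A| == k); rewrite ?andbF //=; case: ifP.
rewrite -!big_split /=; apply: eq_bigr => A cardA; rewrite inE cardA /=.
have excl (C D : {set T}) :
    [disjoint C & D] -> (A \subset C) && (A \subset D) = false.
  rewrite -setI_eq0 => /eqP CD0; apply/negbTE; rewrite -subsetI CD0.
  by rewrite subset0 -cards_eq0 (eqP cardA) -lt0n.
have sub1 : A \subset A1 -> A \subset A1 :|: A2 :|: A3.
  by move=> sA; rewrite -setUA subsetU // sA.
have sub2 : A \subset A2 -> A \subset A1 :|: A2 :|: A3.
  by move=> sA; rewrite setUAC subsetU // sA orbT.
have sub3 : A \subset A3 -> A \subset A1 :|: A2 :|: A3.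
  by move=> sA; rewrite subsetU // sA orbT.
move: (excl _ _ d12) (excl _ _ d13) (excl _ _ d23) sub1 sub2 sub3.
case: (A \subset A1); case: (A \subset A2); case: (A \subset A3) => //= _ _ _;
  by case: (A \subset A1 :|: A2 :|: A3) => // h1 h2 h3;
    first [have := h3 isT | have := h2 isT | have := h1 isT].
Qed.

Lemma mixed_sets_card_gt1 (T : finType) (A1 A2 A3 A : {set T}) k :
  A \in mixed_sets A1 A2 A3 k -> (1 < k)%N.
Proof.
rewrite inE => /and5P [AU /eqP <- nA1 nA2 nA3]; rewrite ltnNge; apply/negP.
rewrite leq_eqVlt ltnS leqn0 cards_eq0 => /orP [/cards1P [x defA]|/eqP A0].
  by move: AU nA1 nA2 nA3; rewrite defA !sub1set !inE; do 3 case: (x \in _).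
by rewrite A0 sub0set in nA1.
Qed.

Lemma card_ord_interval n a b :
  (b <= n)%N -> #|[set i : 'I_n | (a <= i < b)%N]| = (b - a)%N.
Proof.
move=> le_bn; rewrite -sum1dep_card.
rewrite -(big_mkord (fun i => (a <= i < b)%N) (fun=> 1%N)).
rewrite -[RHS]muln1 -sum_nat_const_nat (big_nat_widen _ _ _ _ _ le_bn).
rewrite (big_nat_widenl _ _ _ _ _ (leq0n a)).
by apply: eq_bigl => i; rewrite andbC.
Qed.

(** The prime P1 contains the variables of A1 and A2 but not those of A3, so
    it contains the monomial with support A exactly when A is not contained in
    A3; likewise for P2 and A1, and for P3 and A2. *)
Lemma sqfree_inter3 (K : fieldType) n (P1 P2 P3 : pred nat)
    (A1 A2 A3 : {set 'I_n}) k :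
  {in A1 :|: A2 :|: A3, forall i : 'I_n, P1 i.+1 = (i \notin A3)} ->
  {in A1 :|: A2 :|: A3, forall i : 'I_n, P2 i.+1 = (i \notin A1)} ->
  {in A1 :|: A2 :|: A3, forall i : 'I_n, P3 i.+1 = (i \notin A2)} ->
  sqfree (fun f : {mpoly K[n]} =>
      [/\ var_ideal P1 f, var_ideal P2 f & var_ideal P3 f])
    (A1 :|: A2 :|: A3) k = mixed_sets A1 A2 A3 k.
Proof.
move=> eP1 eP2 eP3; apply/setP => A; rewrite !inE.
case: (boolP (A \subset _)) => //= /subsetP AN; case: (#|A| == k) => //=.
have varE (P : pred nat) (C : {set 'I_n}) :
    {in A1 :|: A2 :|: A3, forall i : 'I_n, P i.+1 = (i \notin C)} ->
    var_ideal P ('X_[mesym1 A] : {mpoly K[n]}) <-> ~~ (A \subset C).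
  move=> eP; rewrite var_ideal_mpolyX; split=> [[i Pi]|/subsetPn [i iA iC]].
    rewrite mnmE; case: (boolP (i \in A)) => // iA _.
    by apply/subsetPn; exists i; rewrite -?eP ?AN.
  by exists i; rewrite ?eP ?AN // mnmE iA.
apply/asboolP/and3P => [[MP1 MP2 MP3]|[nA1 nA2 nA3]].
  by split; [apply/(varE _ _ eP2)|apply/(varE _ _ eP3)|apply/(varE _ _ eP1)].
by split; [apply/(varE _ _ eP1)|apply/(varE _ _ eP2)|apply/(varE _ _ eP3)].
Qed.

(** * The bound for an intersection of three monomial primes *)

Theorem proposition3p6 (K : fieldType) (u s t q r n : nat)
    (P1 P2 P3 I : {mpoly K[n]} -> Prop) (d : nat) (num den : rat) :
  [/\ (0 < u)%N, (u <= s)%N & (s <= t)%N] ->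
  [/\ (t <= q)%N, (q <= r)%N & (r <= n)%N] ->
  P1 = var_ideal (fun k => 1 <= k <= t)%N ->
  P2 = var_ideal (fun k => s + 1 <= k <= r)%N ->
  P3 = var_ideal (fun k => (q + 1 <= k <= n) || (1 <= k <= u))%N ->
  I = (fun f => [/\ P1 f, P2 f & P3 f]) ->
  ~ (forall f, P1 f -> P2 f) -> ~ (forall f, P2 f -> P1 f) ->
  ~ (forall f, P1 f -> P3 f) -> ~ (forall f, P3 f -> P1 f) ->
  ~ (forall f, P2 f -> P3 f) -> ~ (forall f, P3 f -> P2 f) ->
  d = ((s - u) + (q - t) + (n - r))%N ->
  (3 <= n - d)%N ->
  num = 'C(n - d, 3)%:R - 'C(u, 3)%:R - 'C(t - s, 3)%:R - 'C(r - q, 3)%:R ->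
  den = 'C(n - d, 2)%:R - 'C(u, 2)%:R - 'C(t - s, 2)%:R - 'C(r - q, 2)%:R ->
  den != 0 ->
  (sdepth_ideal I)%:R <= 2 + d%:R + num / den.
Proof.
move=> [u0 le_us le_st] [le_tq le_qr le_rn] defP1 defP2 defP3 defI _ _ _ _ _ _.
move=> def_d _ def_num def_den den0.
(* The variable x_k is indexed by k - 1, so that the range a < k <= b becomes
   a <= i < b; the vacuous bound gives the three blocks the same form. *)
pose A1 := [set i : 'I_n | (0 <= i < u)%N].
pose A2 := [set i : 'I_n | (s <= i < t)%N].
pose A3 := [set i : 'I_n | (q <= i < r)%N].
have card1 : #|A1| = u by rewrite card_ord_interval ?subn0; lia.
have card2 : #|A2| = (t - s)%N by rewrite card_ord_interval //; lia.
have card3 : #|A3| = (r - q)%N by rewrite card_ord_interval //; lia.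
have d12 : [disjoint A1 & A2].
  by rewrite -setI_eq0; apply/eqP/setP => i; rewrite !inE; lia.
have d13 : [disjoint A1 & A3].
  by rewrite -setI_eq0; apply/eqP/setP => i; rewrite !inE; lia.
have d23 : [disjoint A2 & A3].
  by rewrite -setI_eq0; apply/eqP/setP => i; rewrite !inE; lia.
have cardA : (#|A1| + #|A2| + #|A3| = n - d)%N by lia.
have mixedE k : (0 < k)%N -> #|mixed_sets A1 A2 A3 k|%:R =
    'C(n - d, k)%:R - 'C(u, k)%:R - 'C(t - s, k)%:R - 'C(r - q, k)%:R :> rat.
  move=> k0; rewrite -cardA -(card_mixed_sets k0 d12 d13 d23).
  by rewrite card1 card2 card3 !natrD; ring.
pose N := A1 :|: A2 :|: A3.
have cardNC : #|~: N| = d.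
  have -> : #|~: N| = (n - #|N|)%N by have := cardsC N; rewrite card_ord; lia.
  have d3 : [disjoint A1 :|: A2 & A3].
    by rewrite -setI_eq0 setIUl setU_eq0 !setI_eq0 d13.
  move: d12 d3; rewrite -!leq_card_setU => /eqP e1 /eqP e2.
  by rewrite /N e2 e1; lia.
have sqfreeE k : sqfree I N k = mixed_sets A1 A2 A3 k.
  rewrite defI defP1 defP2 defP3.
  by apply: sqfree_inter3 => i; rewrite !inE; lia.
have monI : monomial_closed I.
  rewrite defI defP1 defP2 defP3 => f m [f1 f2 f3] mf.
  by split; apply: monomial_closed_var_ideal mf.
have minI (A : {set 'I_n}) : A \subset N -> I 'X_[mesym1 A] -> (2 <= #|A|)%N.
  move=> AN IA; apply: (@mixed_sets_card_gt1 _ A1 A2 A3 A).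
  by rewrite -sqfreeE inE AN eqxx; apply/asboolP.
have := sdepth_ideal_count monI minI.
rewrite !sqfreeE cardNC => le_count.
rewrite -mixedE // in def_num; rewrite -mixedE // in def_den.
have den_gt0 : 0 < den by rewrite lt0r den0 def_den ler0n.
rewrite -lerBlDl ler_pdivlMr // def_num def_den.
apply: (@le_trans _ _
  ((sdepth_ideal I - (2 + d))%:R * #|mixed_sets A1 A2 A3 2|%:R)).
  by rewrite ler_wpM2r // -[2]/(2%:R) -natrD lerBlDl -natrD ler_nat; lia.
by rewrite -natrM ler_nat mulnC.
Qed.
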